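(* Let $D$ and $D'$ be finite simple digraphs such that $D'$ is a butterfly minor of $D$. Then $\mathrm{NCW}_\emptyset(D') \le \mathrm{NCW}_\emptyset(D)$.
   Context: All digraphs are finite and simple. An edge $(u,v)$ of a digraph is butterfly contractible if it is the only edge with tail $u$ or the only edge with head $v$. A butterfly minor of $D$ is a digraph obtained from a subgraph of $D$ by contracting butterfly contractible edges. An abstract digraph decomposition of a digraph $D$ is a triple $(T,\beta,\gamma)$ where $T$ is a rooted directed tree (edges directed away from the root), $\beta:V(T)\to 2^{V(D)}$, $\gamma:E(T)\to 2^{V(D)}$, and $\bigcup_{t\in V(T)}\beta(t)=V(D)$. For $t\in V(T)$ let $\Gamma(t)=\beta(t)\cup\bigcup_{e \text{ incident with } t}\gamma(e)$, let $T_t$ be the subtree of $T$ induced by the nodes reachable from $t$ by a directed path in $T$, and for a subtree $S$ let $\beta(S)=\bigcup_{t\in V(S)}\beta(t)$. The width is $\max\{|\Gamma(t)|-1 : t\in V(T)\}$. An $\mathrm{NCW}_\emptyset$-directed tree decomposition of $D$ is an abstract digraph decomposition such that (1) $\{\beta(t):t\in V(T)\}$ is a partition of $V(D)$ into possibly empty sets with $\beta(r)\neq\emptyset$ for the root $r$ of $T$, and (2) for every edge $e=(s,t)\in E(T)$ there is no closed walk in $D-\gamma(e)$ containing a vertex of $\beta(T_t)$ and a vertex of $V(D)-\beta(T_t)$. $\mathrm{NCW}_\emptyset(D)$ is the minimum width of an $\mathrm{NCW}_\emptyset$-directed tree decomposition of $D$. *)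

(* Defs.v *)
From HB Require Import structures.
From mathcomp Require Import all_boot.
From mathcomp Require Import boolp.

Set Implicit Arguments.
Unset Strict Implicit.
Unset Printing Implicit Defensive.

(* No loops and no parallel edges; antiparallel pairs (u,v), (v,u) are
   allowed. *)
Record digraph := Digraph {
  vertex :> finType;
  edge : rel vertex;
  edge_irr : irreflexive edge
}.

Arguments edge {d} : rename.

Definition butterfly_contractible (D : digraph) (u v : D) : Prop :=
  edge u v /\
  ((forall w : D, edge u w -> w = v) \/ (forall w : D, edge w v -> w = u)).

(* H is isomorphic to a (not necessarily induced or spanning) subgraph of D. *)
Definition is_subgraph (D H : digraph) : Prop :=
  exists f : H -> D,
    injective f /\ forall x y : H, edge x y -> edge (f x) (f y).

(* H' is isomorphic to the simple digraph obtained from H by identifying u with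
   v and dropping the loops and parallel edges this creates; f is the quotient
   map. *)
Definition is_contraction (H : digraph) (u v : H) (H' : digraph) : Prop :=
  exists f : H -> H',
    [/\ forall a : H', exists x : H, f x = a,
        forall x y : H,
          f x = f y <->
          x = y \/ (x \in [set u; v] /\ y \in [set u; v])
      & forall a b : H',
          edge a b <->
          a <> b /\ exists x y : H, [/\ f x = a, f y = b & edge x y]].

(* [butterfly_minor D D'] : D' is a butterfly minor of D. Contractibility is
   tested in the current digraph, after the earlier contractions. *)
Inductive butterfly_minor (D : digraph) : digraph -> Prop :=
| bminor_subgraph (H : digraph) :
    is_subgraph D H -> butterfly_minor D H
| bminor_contract (H : digraph) (u v : H) (H' : digraph) :
    butterfly_minor D H -> butterfly_contractible u v ->
    is_contraction u v H' -> butterfly_minor D H'.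

(* Exactly one directed walk from r to each node: T is a tree with all edges
   directed away from r. *)
Definition rooted_tree (T : digraph) (r : T) : Prop :=
  forall t : T, exists! p : seq T, path edge r p /\ last r p = t.

(* [gamma s t] is meaningful only when (s,t) is an edge of [tree]. *)
Record decomposition (D : digraph) := Decomposition {
  tree : digraph;
  root : tree;
  beta : tree -> {set D};
  gamma : tree -> tree -> {set D};
  treeP : rooted_tree root;
  beta_cover : \bigcup_(t : tree) beta t = [set: D]
}.

Section Decomposition.
Variables (D : digraph) (X : decomposition D).
Implicit Types (s t : tree X).

Definition Gamma t : {set D} :=
  beta t :|: \bigcup_(s | edge s t) gamma s t
         :|: \bigcup_(s | edge t s) gamma t s.

Definition subtree t : {set tree X} := [set s | connect edge t s].

Definition beta_of (S : {set tree X}) : {set D} := \bigcup_(t in S) beta t.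

(* Truncated predecessor: harmless, since the maximum is nonnegative as soon as
   some beta t is nonempty. *)
Definition width : nat := \max_(t : tree X) #|Gamma t|.-1.

(* A closed walk of D - S, as a cyclic sequence of vertices. *)
Definition closed_walk_avoiding (S : {set D}) (c : seq D) : Prop :=
  cycle edge c /\ forall x, x \in c -> x \notin S.

Definition is_NCW_decomposition : Prop :=
  [/\ forall s t, s <> t -> [disjoint beta s & beta t],
      beta (root X) <> set0
    & forall s t, edge s t ->
        ~ exists c : seq D,
            [/\ closed_walk_avoiding (gamma s t) c,
                exists2 x, x \in c & x \in beta_of (subtree t)
              & exists2 y, y \in c & y \in ~: beta_of (subtree t)]].

End Decomposition.

Definition has_NCW_width (D : digraph) (k : nat) : Prop :=
  exists X : decomposition D, is_NCW_decomposition X /\ width X = k.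

(* The minimum of the k such that [has_NCW_width D k]. Only the digraph without
   vertices has no such k; its value is set to 0. *)
Definition NCW (D : digraph) : nat :=
  match pselect (exists k, `[< has_NCW_width D k >]) with
  | left ex => ex_minn ex
  | right _ => 0
  end.

(* Main.v *)
(** Contracting an edge that is the only one leaving [u] (or entering [v])
    lets every closed walk of the minor be lifted: the contracted vertex is
    represented by [v] (resp. [u]), and each edge lifts to a path of length one
    or two between representatives.  Hence a decomposition of [D] pulls back:
    bags are pulled back along the choice of representatives, guards are pushed
    forward along the contraction, and no set [Gamma t] grows.  Only the
    nonemptiness of the root bag can be lost.  But the separation condition on
    a tree edge does not distinguish its two sides, so the tree can be
    re-rooted, one edge at a time, at a node whose bag is nonempty. *)
From mathcomp Require Import all_boot.
From mathcomp Require Import boolp.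
Require Import Defs.

Set Implicit Arguments.
Unset Strict Implicit.
Unset Printing Implicit Defensive.

(** * Rooted trees described by reachability and in-edges *)

Lemma connect_ind (T : finType) (e : rel T) (x : T) (P : T -> Prop) :
    P x -> (forall y z, connect e x y -> P y -> e y z -> P z) ->
  forall z, connect e x z -> P z.
Proof.
move=> Px stepP z /connectP[p pthp ->].
elim/last_ind: p pthp => [|p y IHp] //=.
rewrite rcons_path last_rcons => /andP[pthp ely].
by apply: stepP (IHp pthp) ely; apply/connectP; exists p.
Qed.

Lemma connect_in_edge (T : finType) (e : rel T) (x z : T) :
  connect e x z -> x = z \/ exists2 y, connect e x y & e y z.
Proof.
move=> /connectP[p]; elim/last_ind: p => [|p y _] /=; first by left.
rewrite rcons_path last_rcons => /andP[pthp ely] ->; right.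
by exists (last x p) => //; apply/connectP; exists p.
Qed.

(** This local form can be checked directly after an edge is reversed, unlike uniqueness of
    walks. *)
Lemma rooted_treeP (T : digraph) (r : T) :
  rooted_tree r <->
  [/\ forall t, connect edge r t,
      forall s s' t : T, edge s t -> edge s' t -> s = s'
    & forall s : T, ~~ edge s r].
Proof.
split=> [treeT | [conT uniqT rootT] t].
  have pathto t : exists2 p, path edge r p & last r p = t.
    by have [p [[]]] := treeT t; exists p.
  have path_uniq p q : path edge r p -> path edge r q ->
      last r p = last r q -> p = q.
    move=> pp pq epq; have [s [_ us]] := treeT (last r q).
    by rewrite -(us p) ?(us q).
  split=> [t|s s' t est es't|s].
  - by have [p pp <-] := pathto t; apply/connectP; exists p.
  - have [[p pp lp] [q pq lq]] := (pathto s, pathto s').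
    have /rcons_inj[epq] : rcons p t = rcons q t.
      by apply: path_uniq; rewrite ?rcons_path ?last_rcons ?lp ?lq ?pp ?pq.
    by rewrite -lp -lq epq.
  - apply/negP=> esr; have [p pp lp] := pathto s.
    have : rcons p r = [::].
      by apply: path_uniq; rewrite ?rcons_path ?last_rcons ?lp ?pp.
    by case: p {pp lp}.
have [p pp ->] := connectP (conT t).
(* Two walks with the same end are compared from the end: their last edges agree because
   in-neighbours are unique, and a nonempty walk cannot end at [r]. *)
exists p; split=> // q [pq]; elim/last_ind: p q pp pq => [|p x IHp] q.
  case/lastP: q => [|q y] //= _.
  rewrite rcons_path last_rcons => /andP[_ +] eyr; rewrite eyr => ey.
  by have := rootT (last r q); rewrite ey.
case/lastP: q => [|q y]; rewrite /= !rcons_path !last_rcons.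
  move=> /andP[_ ex] _ er; move: ex; rewrite -er => ex.
  by have := rootT (last r p); rewrite ex.
move=> /andP[pp ex] /andP[pq ey] eyx; rewrite eyx in ey *.
by rewrite (IHp q) // (uniqT _ _ _ ey ex).
Qed.

(** * Separation, and decompositions whose root bag may be empty *)

Definition separates (D : digraph) (S A : {set D}) : Prop :=
  ~ exists c : seq D,
      [/\ closed_walk_avoiding S c,
          exists2 x, x \in c & x \in A
        & exists2 y, y \in c & y \in ~: A].

(** The two witnesses on the walk exchange roles. This is why a reversed tree edge can keep its
    guard. *)
Lemma separatesC (D : digraph) (S A : {set D}) :
  separates S A -> separates S (~: A).
Proof.
move=> sepA [c [cS xA yA]]; apply: sepA; exists c; split=> //.
by rewrite -(setCK A).
Qed.

(* An NCW-decomposition of width at most [k], except that the bag of the root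
   may be empty. *)
Definition separated_decomposition (D : digraph) (k : nat)
    (X : decomposition D) : Prop :=
  [/\ forall s t : tree X, s <> t -> [disjoint beta s & beta t],
      forall s t : tree X, edge s t ->
        separates (gamma s t) (beta_of (subtree t))
    & forall t : tree X, #|Gamma t| <= k.+1].

Lemma beta_exists (D : digraph) (X : decomposition D) (x : D) :
  exists t : tree X, x \in beta t.
Proof.
have /bigcupP[t _ xt] : x \in \bigcup_(t : tree X) beta t.
  by rewrite beta_cover inE.
by exists t.
Qed.

Lemma in_beta_of (D : digraph) (X : decomposition D) (S : {set tree X})
    (t : tree X) (x : D) :
    (forall s t : tree X, s <> t -> [disjoint beta s & beta t]) ->
  x \in beta t -> (x \in beta_of S) = (t \in S).
Proof.
move=> disX xt; apply/bigcupP/idP => [[s sS xs]|tS]; last by exists t.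
have [<- //|/eqP nst] := eqVneq s t.
by have := disjointFr (disX _ _ nst) xs; rewrite xt.
Qed.

Lemma beta_ofC (D : digraph) (X : decomposition D) (S : {set tree X}) :
    (forall s t : tree X, s <> t -> [disjoint beta s & beta t]) ->
  beta_of (~: S) = ~: beta_of S.
Proof.
move=> disX; apply/setP=> x; have [t xt] := beta_exists X x.
by rewrite inE !(in_beta_of _ disX xt) inE.
Qed.

(** * Moving the root to one of its children *)

Section SwapRoot.
Variables (D : digraph) (X : decomposition D) (c : tree X).
Hypothesis rc : edge (root X) c.
Let r := root X.

Let e' : rel (tree X) :=
  [rel x y | edge x y && ((x, y) != (r, c)) || ((x, y) == (c, r))].

Let conT t : connect edge r t.
Proof. by have /rooted_treeP[+ _ _] := @treeP _ X; apply. Qed.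
Let uniqT (s s' t : tree X) : edge s t -> edge s' t -> s = s'.
Proof. by have /rooted_treeP[_ + _] := @treeP _ X; apply. Qed.
Let rootT (s : tree X) : edge s r = false.
Proof. by have /rooted_treeP[_ _ /(_ s)/negbTE] := @treeP _ X. Qed.

Let neq_cr : c != r.
Proof. by apply: contraTneq rc => ->; rewrite rootT. Qed.

Let e'_irr : irreflexive e'.
Proof.
move=> x; rewrite /e' /= edge_irr /=; apply/eqP=> -[-> ecr].
by have := neq_cr; rewrite ecr eqxx.
Qed.

Let T' := Digraph e'_irr.

Let edge_e' (x y : tree X) : x != r -> edge x y -> e' x y.
Proof. by rewrite /e' /= xpair_eqE => /negbTE-> ->. Qed.

Let edge_e'_neq (x y : tree X) : y != c -> edge x y -> e' x y.
Proof. by rewrite /e' /= xpair_eqE => /negbTE-> ->; rewrite andbF. Qed.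

Let e'_root (x : tree X) : ~~ e' x c.
Proof.
rewrite /e' /= !xpair_eqE (negbTE neq_cr) andbF orbF eqxx andbT.
by apply/andP=> -[exc]; rewrite (uniqT exc rc) eqxx.
Qed.

Let e'_to_old (x : tree X) : e' x r -> x = c.
Proof. by rewrite /e' /= rootT => /eqP[]. Qed.

Let e'_edge (x y : tree X) : y != r -> e' x y -> edge x y.
Proof.
by rewrite /e' /= !xpair_eqE => /negbTE->; rewrite andbF orbF => /andP[].
Qed.

Let treeT' : @rooted_tree T' c.
Proof.
apply/rooted_treeP; split=> [t|s s' t est es't|s]; last exact: e'_root.
- have cr : connect e' c r by apply: connect1; rewrite /e' /= eqxx orbT.
  elim/connect_ind: t / (conT t) => // y z _ cy eyz.
  have [-> //|nzc] := eqVneq z c.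
  exact: connect_trans cy (connect1 (edge_e'_neq nzc eyz)).
- have [etr|ntr] := eqVneq t r.
    by move: est es't; rewrite etr => /e'_to_old-> /e'_to_old->.
  exact: uniqT (e'_edge ntr est) (e'_edge ntr es't).
Qed.

(** In the new tree nothing enters [c], and [r] is entered only from [c], so a walk from [t] meets
    neither and uses old edges only. Conversely, an old walk from [t] never reaches [r], hence
    avoids the reversed edge. *)
Let subtree_e' (s t : tree X) : edge s t -> t != c ->
  @connect T' e' t =1 connect edge t.
Proof.
move=> est ntc x; have ntr : t != r.
  by apply: contraTneq est => ->; rewrite rootT.
apply/idP/idP.
- move=> ctx.
  suff [] : [/\ connect edge t x, x != r & x != c] by [].
  elim/connect_ind: x / ctx => // y z _ [cty nyr nyc] eyz.
  have nzr : z != r.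
    by apply: contraNneq nyc => ezr; rewrite (e'_to_old (x:=y)) // -ezr.
  have nzc : z != c by apply: contraTneq eyz => ->; rewrite e'_root.
  by split=> //; apply: connect_trans cty (connect1 (e'_edge nzr eyz)).
- move=> ctx.
  suff [] : connect e' t x /\ x != r by [].
  elim/connect_ind: x / ctx => // y z _ [cty nyr] eyz; split.
    exact: connect_trans cty (connect1 (edge_e' nyr eyz)).
  by apply: contraTneq eyz => ->; rewrite rootT.
Qed.

(** Reversing the edge exchanges its two sides: what lies below [r] afterwards is what did not lie
    below [c] before. *)
Let subtree_old_root (x : tree X) :
  @connect T' e' r x = ~~ connect edge c x.
Proof.
apply/idP/idP.
- elim/connect_ind => [|y z _ ncy eyz].
    apply/negP=> /connect_in_edge[ecr|[y _]]; last by rewrite rootT.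
    by have := neq_cr; rewrite ecr eqxx.
  have [->|nzr] := eqVneq z r.
    apply/negP=> /connect_in_edge[ecr|[s _]]; last by rewrite rootT.
    by have := neq_cr; rewrite ecr eqxx.
  apply/negP=> /connect_in_edge[ecz|[s cs esz]].
    by move: eyz; rewrite -ecz => eyc; have := e'_root y; rewrite eyc.
  by move: ncy; rewrite (uniqT (e'_edge nzr eyz) esz) cs.
- elim/connect_ind: x / (conT x) => [_|y z _ IHy eyz ncz].
    exact: connect0.
  have nzc : z != c by apply: contraNneq ncz => ->; apply: connect0.
  have ncy : ~~ connect edge c y.
    by apply: contra ncz => cy; apply: connect_trans cy (connect1 eyz).
  exact: connect_trans (IHy ncy) (connect1 (edge_e'_neq nzc eyz)).
Qed.

Let gamma' (s t : T') : {set D} :=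
  if ((s, t) == (c, r)) then gamma r c else @gamma _ X s t.

Let Y := @Decomposition D T' c (@beta _ X) gamma' treeT' (beta_cover X).

Let gamma_sub_Gamma (s t : tree X) :
  edge s t -> gamma s t \subset Gamma s :&: Gamma t.
Proof.
move=> est; rewrite subsetI; apply/andP; split; apply/subsetP=> x xg.
  by apply/setUP; right; apply/bigcupP; exists t.
by apply/setUP; left; apply/setUP; right; apply/bigcupP; exists s.
Qed.

Let gamma_sub_GammaY (s t : tree X) :
  e' s t -> gamma' s t \subset Gamma s :&: Gamma t.
Proof.
rewrite /gamma' /e' /=; case: ((s, t) =P (c, r)) => [[-> ->] _|_].
  by rewrite setIC; apply: gamma_sub_Gamma.
by rewrite orbF => /andP[est _]; apply: gamma_sub_Gamma.
Qed.

(** The map [i] is the identity on nodes; it is stated abstractly because the tree itself changes.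
    The clause on paths lets the swap be iterated along a path. *)
Lemma swap_root (k : nat) : separated_decomposition k X ->
  exists Z : decomposition D, exists i : tree X -> tree Z,
    [/\ separated_decomposition k Z, i c = root Z,
        forall t, beta (i t) = beta t
      & forall p, path edge c p -> path edge (i c) (map i p)].
Proof.
move=> [disX sepX cardX]; exists Y, id; split=> //; last first.
  move=> p pcp; rewrite map_id; move: (pcp).
  (* No old edge enters [r], so the path from [c] stays off [r] and every edge of it survives. *)
  apply: (@sub_in_path _ (predC1 r)) => [x y|].
    by move=> nxr _; apply: edge_e'.
  rewrite /= neq_cr; elim: p (c : tree X) pcp => //= y p IHp x.
  case/andP=> exy /IHp->; rewrite andbT.
  by apply: contraTneq exy => ->; rewrite rootT.
split=> [//|s t est|t].
- rewrite /= /gamma'; case: eqP => [[es et]|/eqP nst].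
    suff -> : beta_of (X := Y) (subtree t) = ~: beta_of (subtree c).
      exact/separatesC/sepX.
    rewrite -beta_ofC //; rewrite /beta_of; apply: eq_bigl => x.
    by rewrite !inE et; apply: subtree_old_root.
  have oldst : @edge (tree X) s t && ((s, t) != (r, c)).
    by have : e' s t := est; rewrite /e' /= (negbTE nst) orbF.
  have [{}oldst nrc] := andP oldst.
  suff -> : beta_of (X := Y) (subtree t) = beta_of (subtree (t : tree X)).
    exact: sepX.
  rewrite /beta_of; apply: eq_bigl => x.
  rewrite !inE; apply: (subtree_e' oldst).
  apply: contraNneq nrc => etc; rewrite etc in oldst *.
  by rewrite (uniqT oldst rc).
(* A reversed edge keeps its ends and its guard, so the new [Gamma t] is contained in the old
   one. *)
- apply: leq_trans (subset_leq_card _) (cardX t).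
  apply/subUsetP; split; first apply/subUsetP; first split.
  + by apply/subsetP=> x xt; do 2![apply/setUP; left].
  + by apply/bigcupsP=> s /gamma_sub_GammaY; rewrite subsetI => /andP[].
  + by apply/bigcupsP=> s /gamma_sub_GammaY; rewrite subsetI => /andP[].
Qed.

End SwapRoot.

(** Induction on the length of the tree path from the root to [t], which each swap shortens by
    one. *)
Lemma reroot (D : digraph) (k : nat) (X : decomposition D) (t : tree X) :
    separated_decomposition k X -> beta t != set0 ->
  exists2 Y : decomposition D, separated_decomposition k Y
                             & beta (root Y) <> set0.
Proof.
have /rooted_treeP[conT _ _] := @treeP _ X; have /connectP[p + ->] := conT t.
have [n] := ubnP (size p).
elim: n X p {t conT} => [//|n IHn] X [|c p] /= lt_p_n.
  by move=> _ sepX /eqP; exists X.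
move=> /andP[rc pcp] sepX ntX.
have [Y [i [sepY ic iB ip]]] := swap_root rc sepX.
apply: (IHn Y (map i p)); rewrite ?size_map -?ic ?last_map ?iB //.
exact: ip.
Qed.

(** * Transfer of decompositions along a lifting of edges *)

Section Transfer.
Variables (D D' : digraph) (p : D -> option D') (g : D' -> D).
Hypothesis pg : forall a, p (g a) = Some a.
(** Interior vertices of a lifted edge project to its ends, so lifting a walk brings in no new
    projected vertices. The value [None] of [p] serves vertices outside a subgraph. *)
Hypothesis edge_lift : forall a b : D', edge a b ->
  exists2 s : seq D, path edge (g a) (rcons s (g b))
                   & forall x, x \in s -> p x = Some a \/ p x = Some b.

(** Lifts of single edges are concatenated. The last two clauses keep the walk meeting the required
    bags and off the guards. *)
Lemma path_lift (a : D') (q : seq D') : path edge a q ->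
  exists s : seq D,
    [/\ path edge (g a) s, last (g a) s = g (last a q),
        forall b, b \in q -> g b \in s
      & forall x, x \in s -> exists2 b, b \in a :: q & p x = Some b].
Proof.
elim: q a => [|b q IHq] a /=; first by exists [::].
case/andP=> /edge_lift[s1 ps1 in1] /IHq[s2 [ps2 last2 gs2 in2]].
exists (rcons s1 (g b) ++ s2); split.
- by rewrite cat_path ps1 last_rcons.
- by rewrite last_cat last_rcons.
- move=> d; rewrite inE mem_cat mem_rcons inE => /predU1P[->|/gs2->].
    by rewrite eqxx.
  by rewrite orbT.
- move=> x; rewrite mem_cat mem_rcons inE.
  case/orP=> [/predU1P[->|/in1[] px]|/in2[d dq px]].
  + by exists b => //; rewrite !inE eqxx orbT.
  + by exists a => //; rewrite inE eqxx.
  + by exists b => //; rewrite !inE eqxx orbT.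
  + by exists d => //; rewrite inE dq orbT.
Qed.

Lemma cycle_lift (c' : seq D') : cycle edge c' ->
  exists c : seq D,
    [/\ cycle edge c, forall a, a \in c' -> g a \in c
      & forall x, x \in c -> exists2 a, a \in c' & p x = Some a].
Proof.
case: c' => [|a q] /=; first by exists [::].
case/path_lift=> s [ps + gs ins]; rewrite last_rcons.
(* The lifted walk returns to [g a]; this final repetition is dropped to give a cyclic sequence. *)
case/lastP: s ps gs ins => [|s y] ps gs ins.
  by have /gs : a \in rcons q a by rewrite mem_rcons inE eqxx.
rewrite last_rcons => ey; rewrite {y}ey in ps gs ins.
exists (g a :: s); split=> // [b bq|x xs].
  by rewrite -mem_rcons gs // mem_rcons.
have /ins[b] : x \in rcons s (g a) by rewrite mem_rcons.
by rewrite inE mem_rcons orb_idl => [bq|/eqP->]; [exists b | rewrite mem_head].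
Qed.

Let push (S : {set D}) : {set D'} := [set a | Some a \in p @: S].

Let card_push (S : {set D}) : #|push S| <= #|S|.
Proof.
rewrite -(card_imset _ (@Some_inj _)); apply: leq_trans (leq_imset_card p S).
by apply/subset_leq_card/subsetP=> _ /imsetP[a + ->]; rewrite inE.
Qed.

Let mem_push (S : {set D}) (x : D) (a : D') :
  x \in S -> p x = Some a -> a \in push S.
Proof. by move=> xS px; rewrite inE -px imset_f. Qed.

(** The tree is kept. A closed walk violating separation in [D'] would lift to one in [D]: a lifted
    vertex in a guard would project into the pushed guard. *)
Lemma separated_decomposition_transfer (k : nat) (X : decomposition D) :
    separated_decomposition k X ->
  exists Y : decomposition D', separated_decomposition k Y.
Proof.
move=> [disX sepX cardX].
have cover' : \bigcup_(t : tree X) (g @^-1: beta t) = [set: D'].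
  apply/setP=> a; rewrite inE; have [t gat] := beta_exists X (g a).
  by apply/bigcupP; exists t; rewrite ?inE.
pose Y := @Decomposition D' _ _ (fun t => g @^-1: beta t)
            (fun s t => push (gamma s t)) (@treeP _ X) cover'.
have beta_ofY (S : {set tree X}) a :
    (a \in beta_of (X := Y) S) = (g a \in beta_of S).
  by apply/bigcupP/bigcupP=> -[t tS at_]; exists t; rewrite ?inE // in at_ *.
exists Y; split=> [s t nst|s t est|t].
- apply/pred0P=> a /=; rewrite !inE.
  by apply/andP=> -[/(disjointFr (disX _ _ nst))->].
- move=> [c' [[/cycle_lift[c [cycc gc inc]] avoid] [a ac aY] [b bc bY]]].
  apply: (sepX s t est); exists c; split.
  + split=> // x /inc[d dc' px]; apply: contra (avoid d dc') => xg.
    exact: mem_push xg px.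
  + by exists (g a); [apply: gc | rewrite -beta_ofY].
  + by exists (g b); [apply: gc | rewrite inE -beta_ofY -in_setC].
- apply: leq_trans (cardX t); apply: leq_trans (card_push _).
  apply/subset_leq_card/subsetP=> a /setUP[/setUP[|]|].
  + rewrite inE => gat; apply: mem_push (pg a).
    by do 2![apply/setUP; left].
  + case/bigcupP=> s est; rewrite inE => /imsetP[x xg px].
    apply: mem_push (esym px); apply/setUP; left; apply/setUP; right.
    by apply/bigcupP; exists s.
  + case/bigcupP=> s est; rewrite inE => /imsetP[x xg px].
    apply: mem_push (esym px); apply/setUP; right.
    by apply/bigcupP; exists s.
Qed.

End Transfer.

(** * Subgraphs and butterfly contractions *)

Lemma subgraph_decomposition (D H : digraph) (k : nat) (X : decomposition D) :
    is_subgraph D H -> separated_decomposition k X ->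
  exists Y : decomposition H, separated_decomposition k Y.
Proof.
move=> [f [injf edgef]].
(* The projection is the partial inverse of the embedding, and an edge lifts to a single edge. *)
apply: (@separated_decomposition_transfer _ _ (fun x => [pick a | f a == x]) f).
  by move=> a; case: pickP => [b /eqP/injf-> //|/(_ a)]; rewrite eqxx.
by move=> a b eab; exists [::] => //=; rewrite edgef.
Qed.

Lemma contraction_decomposition (H H' : digraph) (u v : H) (k : nat)
    (X : decomposition H) :
    butterfly_contractible u v -> is_contraction u v H' ->
    separated_decomposition k X ->
  exists Y : decomposition H', separated_decomposition k Y.
Proof.
move=> [euv only] [f [surjf fE edgeE]].
have fuv : f u = f v by apply/fE; right; rewrite !inE !eqxx orbT.
have fib x y : f x = f y -> [\/ x = y, x = u /\ y = v | x = v /\ y = u].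
  case/fE=> [->|[]]; first by constructor 1.
  rewrite !inE => /orP[]/eqP-> /orP[]/eqP->;
    by [constructor 1 | constructor 2 | constructor 3].
have [m mP] : exists m : H, (m = v /\ forall w : H, edge u w -> w = v) \/
    (m = u /\ forall w : H, edge w v -> w = u).
  by case: only => only; [exists v; left | exists u; right].
have fm : f m = f u by case: mP => -[-> _].
(* The default [m] of [odflt] is never reached, since [f] is surjective. *)
pose g a := if a == f u then m else odflt m [pick x | f x == a].
have fg a : f (g a) = a.
  rewrite /g; have [->//|_] := eqVneq; case: pickP => [x /eqP //|nox].
  by have [x fx] := surjf a; have := nox x; rewrite fx eqxx.
have gu : g (f u) = m by rewrite /g eqxx.
apply: (@separated_decomposition_transfer _ _ (Some \o f) g) => [a|a b].
  by rewrite /= fg.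
move=> /edgeE[neq_ab [x [y [fx fy exy]]]].
have := fib x (g a); rewrite fg => /(_ fx) fibx.
have := fib y (g b); rewrite fg => /(_ fy) fiby.
have neq_uv : u <> v by move=> uv; move: euv; rewrite uv edge_irr.
(* A representative lying in the contracted class must be [m]; this excludes the other end of the
   contracted edge. *)
have g_uv d z : g d = z -> f z = f u -> m = z.
  by move=> <-; rewrite fg -gu => ->.
case: mP => -[em onlyE].
- have gE d : g d = u -> False.
    by move=> /g_uv/(_ erefl); rewrite em => /esym.
  case: fibx => [ex|[exu _]|[_ /gE //]].
    case: fiby => [ey|[eyu gbv]|[_ /gE //]].
      by exists [::] => //=; rewrite -ex -ey exy.
    (* The edge ends at [u] but [b] is represented by [v], so the lift continues along [u] to
       [v]. *)
    exists [:: u] => [|z]; first by rewrite /= -ex -{1}eyu exy gbv euv.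
    by rewrite inE => /eqP->; right; rewrite /= -eyu fy.
  (* An edge leaving [u] can only go to [v], and would become a loop. *)
  by case: neq_ab; rewrite -fx -fy exu (onlyE y) // -exu.
- have gE d : g d = v -> False.
    by move=> /g_uv/(_ (esym fuv)); rewrite em.
  case: fiby => [ey|[_ /gE //]|[eyv _]].
    case: fibx => [ex|[_ /gE //]|[exv gau]].
      by exists [::] => //=; rewrite -ex -ey exy.
    (* Dually, [a] is represented by [u], so the lift first goes from [u] to [v]. *)
    exists [:: v] => [|z]; first by rewrite /= gau -ey -exv {1}exv euv exy.
    by rewrite inE => /eqP->; left; rewrite /= -exv fx.
  by case: neq_ab; rewrite -fx -fy eyv (onlyE x) // -eyv.
Qed.

(** * From decompositions to the minimum width *)

Lemma NCW_le (D : digraph) (k : nat) (X : decomposition D) :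
  separated_decomposition k X -> NCW D <= k.
Proof.
rewrite /NCW; case: pselect => [ex|//] sepX.
case: ex_minnP => n /asboolP[Z [ncwZ _]] minn.
(* The decomposition [Z] attaining the minimum serves only to show that [D] has a vertex, hence that
   some bag of [X] is nonempty. *)
have [_ /eqP/set0Pn[x _] _] := ncwZ.
have [t xt] := beta_exists X x.
have /(reroot sepX)[Y sepY rootY] : beta t != set0 by apply/set0Pn; exists x.
have [disY sY cardY] := sepY.
apply: (@leq_trans (width Y)).
  by apply: minn; apply/asboolP; exists Y.
apply/bigmax_leqP=> s _; rewrite -subn1 leq_subLR add1n; exact: cardY.
Qed.

(** A single bag on a one-node tree; the vertex [x] makes the root bag nonempty. *)
Lemma trivial_decomposition (D : digraph) (x : D) : exists k, has_NCW_width D k.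
Proof.
pose T := @Digraph unit (fun _ _ => false) (fun _ => erefl).
have treeT : @rooted_tree T tt.
  apply/rooted_treeP; split=> // t; case: t; exact: connect0.
have cover : \bigcup_(t : T) [set: D] = [set: D].
  by apply/setP=> y; rewrite inE; apply/bigcupP; exists tt.
exists (width (Decomposition (fun _ _ => set0) treeT cover)).
exists (Decomposition (fun _ _ => set0) treeT cover); split=> //.
split=> //; first by case=> -[].
by move=> /= /setP/(_ x); rewrite !inE.
Qed.

Lemma NCW_attained (D : digraph) (x : D) :
  exists X : decomposition D, separated_decomposition (NCW D) X.
Proof.
rewrite /NCW; case: pselect => [ex|[]]; last first.
  by have [k Xk] := trivial_decomposition x; exists k; apply/asboolP.
case: ex_minnP => n /asboolP[X [[disX rootX sepX] <-]] _.
exists X; split=> // t; apply: leq_trans (leqSpred _) _.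
by rewrite ltnS; apply: (leq_bigmax (F := fun t => #|Gamma t|.-1)).
Qed.

(** An empty root bag is tolerated through all steps of the minor construction; re-rooting happens
    once, in [NCW_le]. *)
Lemma butterfly_minor_decomposition (D D' : digraph) (k : nat)
    (X : decomposition D) :
    butterfly_minor D D' -> separated_decomposition k X ->
  exists Y : decomposition D', separated_decomposition k Y.
Proof.
move=> minorD' sepX; elim: minorD' => [H|H u v H' _ [Y sepY]].
  by move=> subH; apply: subgraph_decomposition subH sepX.
by move=> contr contrH'; apply: contraction_decomposition contr contrH' sepY.
Qed.

Lemma butterfly_minor_empty (D D' : digraph) :
  butterfly_minor D D' -> (D -> False) -> D' -> False.
Proof.
move=> + D0; elim=> [H [f _] x|H u v H' _ H0 _ [f [surjf _ _]] a].
  exact: D0 (f x).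
by have [x _] := surjf a; apply: H0.
Qed.

Lemma NCW_empty (D : digraph) : (D -> False) -> NCW D = 0.
Proof.
move=> D0; rewrite /NCW; case: pselect => // ex; case: ex_minnP => n.
by case/asboolP=> X [[_ []]]; apply/setP=> x; case: (D0 x).
Qed.

Theorem theorem4p10 (D D' : digraph) (minorD' : butterfly_minor D D') :
  NCW D' <= NCW D.
Proof.
(* If [D] has no vertex, neither has [D'], whose value is then 0 by convention. *)
have [[x]|D0] := pselect (inhabited D); last first.
  rewrite (@NCW_empty D') //; apply: (butterfly_minor_empty minorD') => x.
  exact: D0 (inhabits x).
have [X sepX] := NCW_attained x.
have [Y sepY] := butterfly_minor_decomposition minorD' sepX.
exact: NCW_le sepY.
Qed.
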